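(* Let $m,n\ge1$, $A\in\mathbb{R}^{m\times n}$, $b\in\mathbb{R}^m$, $c\in\mathbb{R}^n$ be such that the integer program $(\mathrm{IP})$: $\max\{\langle c,x\rangle:Ax\le b,\ x\in\{0,1\}^n\}$ is feasible. Let $(x^*,\lambda^* )$ be a saddle point of the Lagrangian of its LP relaxation, and let $$G=\{x\in\{0,1\}^n:\Delta_{\mathrm{rc}}(x)\le\mathrm{IPGap}\},$$ where $\Delta_{\mathrm{rc}}(x)=\sum_{j=1}^n(c_j-\langle\lambda^*,A^j\rangle)(x^*_j-x_j)$ and $\mathrm{IPGap}$ is the integrality gap. Consider the branch-and-bound algorithm with best-bound node selection rule (and variable branching) for solving $(\mathrm{IP})$. Then its final tree has at most $2|G|n+1$ nodes.
   Context: $A^j$ is the $j$th column of $A$. Integrality gap: $\mathrm{IPGap}=\mathrm{OPT}(\mathrm{LP})-\mathrm{OPT}(\mathrm{IP})$, where $\mathrm{OPT}(\mathrm{IP})=\max\{\langle c,x\rangle:Ax\le b,\ x\in\{0,1\}^n\}$ and $\mathrm{OPT}(\mathrm{LP})=\max\{\langle c,x\rangle:Ax\le b,\ x\in[0,1]^n\}$. Saddle point: $(x^*,\lambda^* )\in[0,1]^n\times\mathbb{R}^m_{\ge0}$ is a saddle point of $\min_{\lambda\ge0}\max_{x\in[0,1]^n}L(x,\lambda)$, where $L(x,\lambda)=\sum_{j=1}^n(c_j-\langle\lambda,A^j\rangle)x_j+\langle b,\lambda\rangle$: $x^*$ maximizes $L(\cdot,\lambda^* )$ over $[0,1]^n$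 and $\lambda^*$ minimizes $L(x^*,\cdot)$ over $\lambda\ge0$. Branch-and-bound algorithm: it constructs a binary tree in which each node has an associated LP; the LP of the root is the relaxation $\max\{\langle c,x\rangle:Ax\le b,\ x\in[0,1]^n\}$. It starts with no current best feasible solution. An infeasible LP has value $-\infty$. While there are unpruned leaves, each iteration does the following. 1. (Best-bound node selection) Select an unpruned leaf $N$ with highest optimal LP value in the current tree, and obtain an optimal solution $\tilde x$ of its LP (if feasible). 2. (Pruning by integrality) If $\tilde x$ is integral, and it has higher value than the current best feasible solution (or none exists), set $\tilde x$ as the current best feasible solution; mark $N$ as pruned. 3. (Pruning by infeasibility/bound) Else, if the LP of $N$ is infeasible or its value is strictly less than that of the current best feasible solution, mark $N$ as pruned. 4. (Branching) Otherwise select any coordinate $j$ where $\tilde x$ is fractional and add two children to $N$: the LP of $N$ with added constraint $x_j=0$, and the LP of $N$ with added constraint $x_j=1$. *)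

(* Defs.v *)
From Stdlib Require Export Relation_Operators.
From HB Require Export structures.
From mathcomp Require Export all_boot all_order all_algebra.
From mathcomp Require Export all_classical all_reals all_analysis.

Set Implicit Arguments.
Unset Strict Implicit.
Unset Printing Implicit Defensive.

Export Order.TTheory GRing.Theory Num.Theory.

Open Scope classical_set_scope.
Open Scope ring_scope.

Definition dot (R : realType) (k : nat) (u v : 'cV[R]_k) : R :=
  \sum_(i < k) u i 0 * v i 0.

Definition is_max (R : realType) (S : set R) (v : R) : Prop :=
  S v /\ ubound S v.

(* The maximum of S, with value -oo when S is empty. (The sets S used below
   are images of compact sets, so that their maximum exists as soon as they
   are nonempty.) *)
Definition maxval (R : realType) (S : set R) : \bar R :=
  xget -oo%E [set v%:E | v in [set v | is_max S v]].

Lemma maxvalE (R : realType) (S : set R) (v : R) :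
  is_max S v -> maxval S = v%:E.
Proof.
move=> [Sv Uv]; apply: xget_unique; first by exists v.
move=> _ [w [Sw Uw] <-]; congr EFin; apply/le_anti.
by rewrite Uv // Uw.
Qed.

Lemma maxval0 (R : realType) : maxval (set0 : set R) = -oo%E.
Proof. by apply: xgetPN => _ [v [[]]]. Qed.

Definition linear_constraints (R : realType) (m n : nat) (A : 'M[R]_(m, n))
    (b : 'cV[R]_m) : set 'cV[R]_n :=
  [set x | forall i, (A *m x) i 0 <= b i 0].

Definition unit_box (R : realType) (n : nat) : set 'cV[R]_n :=
  [set x | forall j, 0 <= x j 0 <= 1].

Definition binary_points (R : realType) (n : nat) : set 'cV[R]_n :=
  [set x | forall j, x j 0 = 0 \/ x j 0 = 1].

Definition ip_feasible (R : realType) (m n : nat) (A : 'M[R]_(m, n))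
    (b : 'cV[R]_m) : set 'cV[R]_n :=
  linear_constraints A b `&` @binary_points R n.

(* The relaxation with the additional constraints x_j = v for (j, v) in F,
   where the booleans false and true stand for the values 0 and 1. *)
Definition lp_feasible (R : realType) (m n : nat) (A : 'M[R]_(m, n))
    (b : 'cV[R]_m) (F : seq ('I_n * bool)) : set 'cV[R]_n :=
  linear_constraints A b `&` @unit_box R n `&`
  [set x | forall j v, (j, v) \in F -> x j 0 = v%:R].

Definition ip_opt (R : realType) (m n : nat) (A : 'M[R]_(m, n))
    (b : 'cV[R]_m) (c : 'cV[R]_n) : \bar R :=
  maxval (dot c @` ip_feasible A b).

Definition lp_opt (R : realType) (m n : nat) (A : 'M[R]_(m, n))
    (b : 'cV[R]_m) (c : 'cV[R]_n) (F : seq ('I_n * bool)) : \bar R :=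
  maxval (dot c @` lp_feasible A b F).

Definition lp_solution (R : realType) (m n : nat) (A : 'M[R]_(m, n))
    (b : 'cV[R]_m) (c : 'cV[R]_n) (F : seq ('I_n * bool)) (x : 'cV[R]_n) :
    Prop :=
  lp_feasible A b F x /\
  forall y, lp_feasible A b F y -> dot c y <= dot c x.

Definition ipgap (R : realType) (m n : nat) (A : 'M[R]_(m, n))
    (b : 'cV[R]_m) (c : 'cV[R]_n) : \bar R :=
  (lp_opt A b c [::] - ip_opt A b c)%E.

Definition lagrangian (R : realType) (m n : nat) (A : 'M[R]_(m, n))
    (b : 'cV[R]_m) (c : 'cV[R]_n) (x : 'cV[R]_n) (l : 'cV[R]_m) : R :=
  \sum_(j < n) (c j 0 - dot l (col j A)) * x j 0 + dot b l.

Definition nonneg (R : realType) (m : nat) : set 'cV[R]_m :=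
  [set l | forall i, 0 <= l i 0].

Definition saddle_point (R : realType) (m n : nat) (A : 'M[R]_(m, n))
    (b : 'cV[R]_m) (c : 'cV[R]_n) (xs : 'cV[R]_n) (ls : 'cV[R]_m) : Prop :=
  [/\ unit_box xs, nonneg ls,
      forall x, unit_box x -> lagrangian A b c x ls <= lagrangian A b c xs ls &
      forall l, nonneg l -> lagrangian A b c xs ls <= lagrangian A b c xs l].

Definition delta_rc (R : realType) (m n : nat) (A : 'M[R]_(m, n))
    (c : 'cV[R]_n) (xs : 'cV[R]_n) (ls : 'cV[R]_m) (x : 'cV[R]_n) : R :=
  \sum_(j < n) (c j 0 - dot ls (col j A)) * (xs j 0 - x j 0).

Definition of_bits (R : realType) (n : nat) (x : 'cV[bool]_n) : 'cV[R]_n :=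
  map_mx (fun v : bool => v%:R) x.

(* The elements of {0,1}^n are encoded by Boolean vectors, in order to have a
   finite set with a cardinal. *)
Definition near_opt_set (R : realType) (m n : nat) (A : 'M[R]_(m, n))
    (b : 'cV[R]_m) (c : 'cV[R]_n) (xs : 'cV[R]_n) (ls : 'cV[R]_m) :
    {set 'cV[bool]_n} :=
  [set x : 'cV[bool]_n |
    ((delta_rc A c xs ls (of_bits R x))%:E <= ipgap A b c)%E]%SET.

(* [Leaf p]: a leaf, marked as pruned iff p is true.
   [Branch j t0 t1]: a node that was branched on coordinate j; t0 is the
   subtree of the child x_j = 0 and t1 that of the child x_j = 1. *)
Inductive bbtree (n : nat) : Type :=
| Leaf of bool
| Branch of 'I_n & bbtree n & bbtree n.

Arguments Leaf {n} _.

Fixpoint nb_nodes (n : nat) (t : bbtree n) : nat :=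
  if t is Branch _ t0 t1 then (1 + nb_nodes t0 + nb_nodes t1)%N else 1%N.

(* Nodes are designated by their path from the root: false goes to the child
   x_j = 0 and true to the child x_j = 1. *)
Fixpoint subtree (n : nat) (t : bbtree n) (p : seq bool) : option (bbtree n) :=
  match p, t with
  | [::], _ => Some t
  | v :: q, Branch _ t0 t1 => subtree (if v then t1 else t0) q
  | _ :: _, Leaf _ => None
  end.

(* The constraints x_j = v added along the path p. *)
Fixpoint fixings (n : nat) (t : bbtree n) (p : seq bool) : seq ('I_n * bool) :=
  match p, t with
  | v :: q, Branch j t0 t1 => (j, v) :: fixings (if v then t1 else t0) q
  | _, _ => [::]
  end.

(* t with its subtree at p replaced by s. *)
Fixpoint graft (n : nat) (t : bbtree n) (p : seq bool) (s : bbtree n) :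
    bbtree n :=
  match p, t with
  | [::], _ => s
  | v :: q, Branch j t0 t1 =>
      if v then Branch j t0 (graft t1 q s) else Branch j (graft t0 q s) t1
  | _ :: _, Leaf _ => t
  end.

Definition unpruned_leaf (n : nat) (t : bbtree n) (p : seq bool) : Prop :=
  subtree t p = Some (Leaf false).

Definition best_bound_leaf (R : realType) (m n : nat) (A : 'M[R]_(m, n))
    (b : 'cV[R]_m) (c : 'cV[R]_n) (t : bbtree n) (p : seq bool) : Prop :=
  unpruned_leaf t p /\
  forall q, unpruned_leaf t q ->
    (lp_opt A b c (fixings t q) <= lp_opt A b c (fixings t p))%E.

Definition integral (R : realType) (n : nat) (x : 'cV[R]_n) : Prop :=
  forall j, x j 0 \is a Num.int.

(* Current tree and current best feasible solution, if any. *)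
Definition bbstate (R : realType) (n : nat) : Type :=
  (bbtree n * option 'cV[R]_n)%type.

Definition bb_init (R : realType) (n : nat) : bbstate R n := (Leaf false, None).

Definition update_best (R : realType) (n : nat) (c : 'cV[R]_n)
    (best : option 'cV[R]_n) (x : 'cV[R]_n) : option 'cV[R]_n :=
  if best is Some y then (if dot c y < dot c x then Some x else Some y)
  else Some x.

Definition prune_by_bound (R : realType) (m n : nat) (A : 'M[R]_(m, n))
    (b : 'cV[R]_m) (c : 'cV[R]_n) (best : option 'cV[R]_n)
    (F : seq ('I_n * bool)) : Prop :=
  if best is Some y then (lp_opt A b c F < (dot c y)%:E)%E else False.

(* One iteration. It is a relation, since the choices of the leaf (among ties),
   of the optimal solution x and of the fractional coordinate j are arbitrary.
   A leaf whose solution x is integral is pruned in all cases, also when x does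
   not improve on the current best solution: no branching is possible then. *)
Inductive bb_step (R : realType) (m n : nat) (A : 'M[R]_(m, n))
    (b : 'cV[R]_m) (c : 'cV[R]_n) : bbstate R n -> bbstate R n -> Prop :=
| BBIntegral t best p x :
    best_bound_leaf A b c t p ->
    lp_solution A b c (fixings t p) x ->
    integral x ->
    bb_step A b c (t, best) (graft t p (Leaf true), update_best c best x)
| BBInfeasible t best p :
    best_bound_leaf A b c t p ->
    lp_feasible A b (fixings t p) = set0 ->
    bb_step A b c (t, best) (graft t p (Leaf true), best)
| BBBound t best p x :
    best_bound_leaf A b c t p ->
    lp_solution A b c (fixings t p) x ->
    ~ integral x ->
    prune_by_bound A b c best (fixings t p) ->
    bb_step A b c (t, best) (graft t p (Leaf true), best)
| BBBranch t best p x j :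
    best_bound_leaf A b c t p ->
    lp_solution A b c (fixings t p) x ->
    ~ integral x ->
    ~ prune_by_bound A b c best (fixings t p) ->
    x j 0 \isn't a Num.int ->
    bb_step A b c (t, best)
      (graft t p (Branch j (Leaf false) (Leaf false)), best).

Definition bb_reachable (R : realType) (m n : nat) (A : 'M[R]_(m, n))
    (b : 'cV[R]_m) (c : 'cV[R]_n) (s : bbstate R n) : Prop :=
  clos_refl_trans _ (bb_step A b c) (bb_init R n) s.

Definition bb_final (R : realType) (n : nat) (s : bbstate R n) : Prop :=
  forall p, ~ unpruned_leaf s.1 p.

Definition bb_final_tree (R : realType) (m n : nat) (A : 'M[R]_(m, n))
    (b : 'cV[R]_m) (c : 'cV[R]_n) (t : bbtree n) : Prop :=
  exists2 s : bbstate R n, bb_reachable A b c s & bb_final s /\ s.1 = t.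

(* Every execution, whatever the choices made, reaches a final state: it is
   finite, and an iteration is possible as long as some leaf is unpruned. *)
Definition bb_terminates (R : realType) (m n : nat) (A : 'M[R]_(m, n))
    (b : 'cV[R]_m) (c : 'cV[R]_n) : Prop :=
  Acc (fun s' s => bb_step A b c s s') (bb_init R n) /\
  forall s, bb_reachable A b c s -> ~ bb_final s ->
    exists s', bb_step A b c s s'.

(* Main.v *)
(* By the best-bound rule, a node is branched on only if its LP value is at
   least OPT(IP): until an optimal solution z of (IP) or a point as good as z
   has been found, some unpruned leaf contains z. The saddle point turns this
   into delta_rc x <= IPGap for the LP solution x of the node, and rounding the
   free coordinates of x according to the signs of the reduced costs gives a
   point of G in the subcube of the node. A branching fixes a free coordinate,
   so the depth is at most n, and the subcubes of the nodes of one level are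
   disjoint: there are at most |G| n branchings. *)

Require Import Defs.
From Stdlib Require Import Operators_Properties.
From mathcomp Require Import zify.

Import numFieldNormedType.Exports.

Set Implicit Arguments.
Unset Strict Implicit.
Unset Printing Implicit Defensive.

(** * Inner products *)

Lemma dotE (R : realType) k (u v : 'cV[R]_k) : dot u v = (u^T *m v) 0 0.
Proof. by rewrite mxE; apply: eq_bigr => i _; rewrite mxE. Qed.

Lemma dotC (R : realType) k (u v : 'cV[R]_k) : dot u v = dot v u.
Proof. by apply: eq_bigr => i _; rewrite mulrC. Qed.

Lemma dotBr (R : realType) k (u v w : 'cV[R]_k) :
  dot u (v - w) = dot u v - dot u w.
Proof. by rewrite !dotE mulmxBr !mxE. Qed.

Lemma dot_mulmx (R : realType) m n (A : 'M[R]_(m, n)) l x :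
  dot l (A *m x) = \sum_(j < n) dot l (col j A) * x j 0.
Proof.
rewrite dotE mulmxA mxE; apply: eq_bigr => j _; congr (_ * _).
by rewrite mxE; apply: eq_bigr => i _; rewrite !mxE.
Qed.

Lemma dot_ge0 (R : realType) k (u v : 'cV[R]_k) :
  nonneg u -> nonneg v -> 0 <= dot u v.
Proof. by move=> u0 v0; apply: sumr_ge0 => i _; exact: mulr_ge0. Qed.

(** * Lagrangian duality at a saddle point *)

Section lagrangian_duality.
Variables (R : realType) (m n : nat) (A : 'M[R]_(m, n)).
Variables (b : 'cV[R]_m) (c : 'cV[R]_n).

Lemma lagrangianE x l :
  lagrangian A b c x l = dot c x + dot l (b - A *m x).
Proof.
rewrite /lagrangian dotBr dot_mulmx (dotC b).
under eq_bigr do rewrite mulrBl.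
by rewrite sumrB addrAC addrA.
Qed.

(** Weak duality: by [lagrangianE] the excess pairs nonnegative multipliers with nonnegative
    slacks. *)
Lemma lagrangian_ge x l :
  linear_constraints A b x -> nonneg l -> dot c x <= lagrangian A b c x l.
Proof.
move=> Ax l0; rewrite lagrangianE lerDl dot_ge0// => i.
by rewrite !mxE subr_ge0; have := Ax i; rewrite mxE.
Qed.

Lemma delta_rcE xs ls x : delta_rc A c xs ls x =
  lagrangian A b c xs ls - lagrangian A b c x ls.
Proof.
rewrite /lagrangian opprD addrACA subrr addr0 -sumrB.
by apply: eq_bigr => j _; rewrite mulrBr.
Qed.

Variables (xs : 'cV[R]_n) (ls : 'cV[R]_m).
Hypothesis saddle : saddle_point A b c xs ls.

(** Raising the multiplier of row [i] by one changes the Lagrangian by the slack of that row at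
    [xs], so minimality of [ls] makes the slack nonnegative. *)
Lemma saddle_feasible : linear_constraints A b xs.
Proof.
case: saddle => _ ls0 _ minl i.
have e0 : nonneg (ls + delta_mx i 0).
  by move=> k; rewrite !mxE addr_ge0// ler0n.
have := minl _ e0; rewrite !lagrangianE lerD2l.
have -> (w : 'cV[R]_m) : dot (ls + delta_mx i 0) w = dot ls w + w i 0.
  by rewrite !dotE [_^T]raddfD mulmxDl mxE /= trmx_delta -rowE [row i w 0 0]mxE.
by rewrite lerDl [(b - _) i 0]mxE [X in _ + X]mxE subr_ge0.
Qed.

(** Complementary slackness: comparing [ls] with the zero multiplier gives one inequality, weak
    duality the other. *)
Lemma saddle_lagrangian : lagrangian A b c xs ls = dot c xs.
Proof.
case: saddle => _ ls0 _ minl; apply/le_anti/andP; split; last first.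
  by apply: lagrangian_ge => //; exact: saddle_feasible.
have n0 : nonneg (0 : 'cV[R]_m) by move=> k; rewrite mxE.
have := minl _ n0; rewrite [leRHS]lagrangianE.
by rewrite [dot 0 _]dotE linear0 mul0mx !mxE addr0.
Qed.

Lemma saddle_lp_solution : lp_solution A b c [::] xs.
Proof.
case: (saddle) => bxs ls0 maxx _; split.
  by split=> //; split=> //; exact: saddle_feasible.
move=> y [[Ay by_] _]; rewrite -saddle_lagrangian.
by apply: le_trans (maxx _ by_); exact: lagrangian_ge.
Qed.

Lemma delta_rc_le x : linear_constraints A b x ->
  delta_rc A c xs ls x <= dot c xs - dot c x.
Proof.
case: saddle => _ ls0 _ _ Ax.
by rewrite delta_rcE saddle_lagrangian lerB// lagrangian_ge.
Qed.

End lagrangian_duality.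

(** * Existence of optimal solutions *)

Section linear_programs.
Variables (R : realType) (m n : nat) (A : 'M[R]_(m, n)).
Variables (b : 'cV[R]_m) (c : 'cV[R]_n).

Lemma linear_form_continuous (u : 'I_n -> R) :
  continuous (fun v : 'rV[R]_n => \sum_(j < n) u j * v 0 j).
Proof.
apply: continuous_big => [|j _ v]; first exact: add_continuous.
by apply: continuousM; [exact: cst_continuous|exact: coord_continuous].
Qed.

Lemma lp_feasible_compact F :
  compact [set v : 'rV[R]_n | lp_feasible A b F v^T].
Proof.
have box : compact [set v : 'rV[R]_n | forall j, `[0, 1]%classic (v 0 j)].
  by apply: (@rV_compact R _ (fun=> `[0, 1]%classic)) => _; exact: segment_compact.
apply: subclosed_compact box _; last first.
  by move=> v [[_ bv] _] j; have := bv j; rewrite mxE /= in_itv/=.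
(* Closedness: each constraint is the preimage of a closed set under a continuous map. *)
have -> : [set v : 'rV[R]_n | lp_feasible A b F v^T] =
  (\bigcap_(i in setT)
     (fun v : 'rV[R]_n => \sum_j A i j * v 0 j) @^-1` [set y | y <= b i 0]) `&`
  (\bigcap_(j in setT) (fun v : 'rV[R]_n => v 0 j) @^-1` `[0, 1]%classic) `&`
  (\bigcap_(jv in [set` F]) (fun v : 'rV[R]_n => v 0 jv.1) @^-1`
     [set y | y = (jv.2)%:R]).
  have AvE (v : 'rV[R]_n) i : (A *m v^T) i 0 = \sum_j A i j * v 0 j.
    by rewrite mxE; apply: eq_bigr => j _; rewrite mxE.
  apply/seteqP; split=> v /= [[Av bv] Fv]; split; try split.
  - by move=> i _ /=; rewrite -AvE.
  - by move=> j _ /=; have := bv j; rewrite mxE in_itv.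
  - by move=> [j w] /= jF; have := Fv _ _ jF; rewrite mxE.
  - by move=> i; rewrite AvE; exact: Av.
  - by move=> j; have := bv j I; rewrite /= in_itv/= mxE.
  - by move=> j w jF; rewrite mxE; exact: (Fv (j, w)).
apply: closedI; first apply: closedI; apply: closed_bigI => i _.
- apply: preimage_closed; last exact: closed_le.
  by move=> v _; exact: linear_form_continuous.
- apply: preimage_closed; last exact: interval_closed.
  by move=> v _; exact: coord_continuous.
- apply: preimage_closed; last exact: closed_eq.
  by move=> v _; exact: coord_continuous.
Qed.

Lemma lp_solution_exists F :
  lp_feasible A b F !=set0 -> exists x, lp_solution A b c F x.
Proof.
move=> [x0 fx0].
have ne : [set v : 'rV[R]_n | lp_feasible A b F v^T] !=set0.
  by exists x0^T; rewrite /= trmxK.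
have [|v] := compact_EVT_max (f := fun v : 'rV[R]_n => \sum_j c j 0 * v 0 j)
  ne (@lp_feasible_compact F).
  by apply: continuous_subspaceT; exact: linear_form_continuous.
rewrite inE /= => fv vmax; exists v^T; split=> // y fy.
have dotT (w : 'rV[R]_n) : dot c w^T = \sum_j c j 0 * w 0 j.
  by apply: eq_bigr => j _; rewrite mxE.
by rewrite -[y]trmxK !dotT; apply: vmax; rewrite inE /= trmxK.
Qed.

Lemma lp_optE F x : lp_solution A b c F x -> lp_opt A b c F = (dot c x)%:E.
Proof.
move=> [fx xmax]; apply: maxvalE; split; first by exists x.
by move=> _ [y fy <-]; exact: xmax.
Qed.

(** Attainment matters here: without a maximum, [maxval] would fall back to [-oo]. *)
Lemma lp_opt_ge F x : lp_feasible A b F x -> ((dot c x)%:E <= lp_opt A b c F)%E.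
Proof.
move=> fx; have [|y ysol] := @lp_solution_exists F; first by exists x.
by rewrite (lp_optE ysol) lee_fin; exact: ysol.2.
Qed.

Lemma binary_unit_box (x : 'cV[R]_n) : binary_points x -> unit_box x.
Proof. by move=> bx j; case: (bx j) => ->; rewrite !lexx ?ler01. Qed.

Lemma binary_of_bits (x : 'cV[R]_n) :
  binary_points x -> exists y, x = of_bits R y.
Proof.
move=> bx; exists (map_mx (fun a => a == 1) x); apply/colP => j; rewrite !mxE.
by case: (bx j) => ->; rewrite ?eqxx// eq_sym oner_eq0.
Qed.

Lemma ip_solution_exists : ip_feasible A b !=set0 ->
  exists2 z, ip_feasible A b z &
    forall y, ip_feasible A b y -> dot c y <= dot c z.
Proof.
move=> [x0 [Ax0 bx0]].
pose P (y : 'cV[bool]_n) := `[< ip_feasible A b (of_bits R y) >].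
have [y0 x0E] := binary_of_bits bx0.
have Py0 : P y0 by apply/asboolP; rewrite -x0E; split.
case: (arg_maxP (fun y => dot c (of_bits R y)) Py0) => z /asboolP Pz zmax.
exists (of_bits R z) => // y fy; have [w yE] := binary_of_bits fy.2.
by rewrite yE; apply: zmax; apply/asboolP; rewrite -yE.
Qed.

Lemma ip_optE z : ip_feasible A b z ->
  (forall y, ip_feasible A b y -> dot c y <= dot c z) ->
  ip_opt A b c = (dot c z)%:E.
Proof.
move=> fz zmax; apply: maxvalE; split; first by exists z.
by move=> _ [y fy <-]; exact: zmax.
Qed.

End linear_programs.

(** * Rounding an LP solution into the near-optimal set *)

Definition satisfies n (F : seq ('I_n * bool)) (x : 'cV[bool]_n) : bool :=
  all (fun jv => x jv.1 0 == jv.2) F.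

(* Coordinates of x that are 0 or 1 are kept; rounding another x_j according
   to the sign of its coefficient can only decrease delta_rc. *)
Lemma near_opt_rounding (R : realType) m n (A : 'M[R]_(m, n)) b c xs ls z F x :
  saddle_point A b c xs ls ->
  ip_feasible A b z -> (forall y, ip_feasible A b y -> dot c y <= dot c z) ->
  lp_feasible A b F x -> dot c z <= dot c x ->
  exists2 y, y \in near_opt_set A b c xs ls & satisfies F y.
Proof.
move=> saddle fz zmax [[Ax bx] Fx] zx.
pose rc j := c j 0 - dot ls (col j A).
pose y : 'cV[bool]_n := \col_j
  (if x j 0 == 0 then false else if x j 0 == 1 then true else 0 <= rc j).
exists y; last first.
  (* The constraints in [F] already force these coordinates of [x] to 0 or 1. *)
  apply/allP => -[j v] /Fx /=; rewrite mxE => ->.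
  by case: v; rewrite ?eqxx// oner_eq0.
rewrite inE /ipgap (lp_optE (saddle_lp_solution saddle)) (ip_optE fz zmax).
rewrite -EFinB lee_fin.
have /le_trans : delta_rc A c xs ls (of_bits R y) <= delta_rc A c xs ls x.
  apply: ler_sum => j _; rewrite -/(rc j) /of_bits !mxE.
  have /andP[x0 x1] := bx j.
  have [->//|_] := eqVneq (x j 0) 0; have [->//|_] := eqVneq (x j 0) 1.
  case: (leP 0 (rc j)) => [rc0|/ltW rc0]; first by rewrite ler_wpM2l// lerD2l lerN2.
  by rewrite ler_wnM2l// lerD2l lerN2.
(* The gap is [dot c xs - dot c z], so [dot c z <= dot c x] is exactly what is missing. *)
by apply; apply: le_trans (delta_rc_le saddle Ax) _; rewrite lerD2l lerN2.
Qed.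

(** * Search trees: grafting, node count and weight *)

Section trees.
Variable n : nat.
Implicit Types (t s : bbtree n) (p q : seq bool) (F : seq ('I_n * bool)).
Implicit Types (G : {set 'cV[bool]_n}).

Lemma size_fixings t p s : subtree t p = Some s -> size (fixings t p) = size p.
Proof.
by elim: p t => [|v p IH] [a|j t0 t1] //=; case: v => /IH ->.
Qed.

Lemma subtree_graft t p s q : subtree t p ->
  subtree (graft t p s) (p ++ q) = subtree s q.
Proof. by elim: p t => [|[] p IH] [a|j t0 t1] //=; exact: IH. Qed.

Lemma fixings_graft t p s q : subtree t p ->
  fixings (graft t p s) (p ++ q) = fixings t p ++ fixings s q.
Proof.
by elim: p t => [|[] p IH] [a|j t0 t1] //= /IH ->.
Qed.

(** Distinct paths to leaves are never prefixes of each other, so they part at a branching and the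
    graft happens away from [q]. *)
Lemma graft_other_leaf t p q s a a' :
  subtree t p = Some (Leaf a) -> subtree t q = Some (Leaf a') -> q != p ->
  subtree (graft t p s) q = Some (Leaf a') /\
  fixings (graft t p s) q = fixings t q.
Proof.
elim: p t q => [|v p IH] [d|j t0 t1] [|w q] //=.
rewrite eqseq_cons; case: v w => -[] //= tp tq.
  by move=> /(IH _ _ tp tq)[-> ->].
by move=> /(IH _ _ tp tq)[-> ->].
Qed.

(* F is the list of the constraints of the root of t. *)
Fixpoint covered G F t : bool :=
  if t is Branch j t0 t1 then
    [&& j \notin unzip1 F, [exists x in G, satisfies F x],
        covered G (rcons F (j, false)) t0 & covered G (rcons F (j, true)) t1]
  else true.

(** The condition at a node depends only on its path from the root, so the surviving nodes keep
    theirs. *)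
Lemma covered_graft G F t p s : covered G F t ->
  covered G (F ++ fixings t p) s -> covered G F (graft t p s).
Proof.
elim: p t F => [|v p IH] [a|j t0 t1] F //=; rewrite ?cats0//.
case: v => /and4P[jF exF c0 c1]; rewrite -cat_rcons => cs /=.
  by rewrite jF exF c0 IH.
by rewrite jF exF c1 IH.
Qed.

(** Each branching of a covered tree uses a coordinate that is new on its path; this bounds the
    depth by [n]. *)
Lemma uniq_fixings G F t p : covered G F t -> uniq (unzip1 F) ->
  uniq (unzip1 (F ++ fixings t p)).
Proof.
elim: p t F => [|v p IH] [a|j t0 t1] F /=; rewrite ?cats0//.
move=> /and4P[jF _ c0 c1] uF; rewrite -cat_rcons; apply: IH.
  by case: v.
by rewrite /unzip1 map_rcons rcons_uniq jF.
Qed.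

(* In each level of the tree, the subcubes of the nodes are disjoint, so that
   a point of G is counted at most once per level. *)
Lemma nb_nodes_covered G F t : covered G F t -> uniq (unzip1 F) ->
  (nb_nodes t <= 2 * #|[set x in G | satisfies F x]| * (n - size F) + 1)%N.
Proof.
elim: t F => [a|j t0 IH0 t1 IH1] F /=; first by rewrite leq_addl.
move=> /and4P[jF /exists_inP[x xG Fx] c0 c1] uF.
have uFv v : uniq (unzip1 (rcons F (j, v))).
  by rewrite /unzip1 map_rcons rcons_uniq jF.
have := IH0 _ c0 (uFv _); have := IH1 _ c1 (uFv _); rewrite !size_rcons.
set S := [set x in G | satisfies F x]%SET.
have Sv v : [set x in G | satisfies (rcons F (j, v)) x]%SET =
            [set x in S | x j 0 == v]%SET.
  by apply/setP => y; rewrite !inE /satisfies all_rcons andbA andbAC.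
have SE : #|S| = (#|[set x in G | satisfies (rcons F (j, false)) x]%SET| +
                  #|[set x in G | satisfies (rcons F (j, true)) x]%SET|)%N.
  rewrite !Sv -(cardsID [set x : 'cV[bool]_n | x j 0 == false]%SET S).
  congr (_ + _)%N; apply: eq_card => y; rewrite !inE ?andbA//.
  by case: (y j 0); case: (y \in G); case: satisfies.
have S0 : (0 < #|S|)%N by apply/card_gt0P; exists x; rewrite inE xG.
(* As [j] is not yet fixed, a level remains and [n - size F] is not truncated. *)
have sF : (size F < n)%N.
  have /card_uniqP sz : uniq (j :: unzip1 F) by rewrite /= jF.
  by have := max_card (mem (j :: unzip1 F)); rewrite sz /= card_ord size_map.
have -> : (n - size F = (n - (size F).+1).+1)%N by lia.
(* With [d = n - (size F).+1], parent and children total at most [2|S|d + 3], which is at most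
   [2|S|(d + 1) + 1] because [S] is nonempty. *)
move: S0; rewrite SE mulnS mulnDr mulnDl; lia.
Qed.

(* Base 3 makes the two children of a branching together lighter than the
   leaf they replace. *)
Fixpoint weight k t : nat :=
  match t with
  | Leaf pruned => if pruned then 0%N else (3 ^ k)%N
  | Branch _ t0 t1 => (weight k.-1 t0 + weight k.-1 t1)%N
  end.

(** [k - size p] is the exponent reached at the end of [p]; contributions off the path do not
    change. *)
Lemma weight_graft k t p s : subtree t p = Some (Leaf false) ->
  (weight (k - size p) s < 3 ^ (k - size p))%N ->
  (weight k (graft t p s) < weight k t)%N.
Proof.
elim: p t k => [|v p IH] [a|j t0 t1] k //=.
- by move=> [->]; rewrite subn0.
- have -> : (k - (size p).+1 = k.-1 - size p)%N by lia.
  by case: v => tp /(IH _ _ tp) /= ?; rewrite ?ltn_add2l ?ltn_add2r.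
Qed.

(** The induction varies [f]: each child is searched with [f] precomposed with the step into it. *)
Lemma leaf_argmax (R : realType) (f : seq bool -> \bar R) t p :
  unpruned_leaf t p -> exists2 q, unpruned_leaf t q &
    forall q', unpruned_leaf t q' -> (f q' <= f q)%E.
Proof.
elim: t f p => [a|j t0 IH0 t1 IH1] f p.
  case: p => //= tp; exists [::] => // -[]//.
have sub v : (exists q, unpruned_leaf (if v then t1 else t0) q) ->
    exists2 q, unpruned_leaf (if v then t1 else t0) q &
    forall q', unpruned_leaf (if v then t1 else t0) q' ->
      (f (v :: q') <= f (v :: q))%E.
  by case: v => -[q tq]; [exact: IH1 tq|exact: IH0 tq].
have [h0|h0] := pselect (exists q, unpruned_leaf t0 q); last first.
  case: p => // -[] p tp; last by case: h0; exists p.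
  have [q tq qmax] := sub true (ex_intro _ p tp).
  exists (true :: q) => // -[]// [] q' tq'; first exact: qmax.
  by case: h0; exists q'.
have [q0 tq0 q0max] := sub false h0.
have [h1|h1] := pselect (exists q, unpruned_leaf t1 q); last first.
  exists (false :: q0) => // -[]// [] q' tq'; last exact: q0max.
  by case: h1; exists q'.
have [q1 tq1 q1max] := sub true h1.
have [le01|/ltW le10] := leP (f (false :: q0)) (f (true :: q1)).
  exists (true :: q1) => // -[]// [] q' tq'; first exact: q1max.
  by apply: le_trans le01; exact: q0max.
exists (false :: q0) => // -[]// [] q' tq'; last exact: q0max.
by apply: le_trans le10; exact: q1max.
Qed.

End trees.

(** * The invariant of branch-and-bound *)

Section invariant.
Variables (R : realType) (m n : nat) (A : 'M[R]_(m, n)).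
Variables (b : 'cV[R]_m) (c : 'cV[R]_n).
Variables (xs : 'cV[R]_n) (ls : 'cV[R]_m).
Hypothesis saddle : saddle_point A b c xs ls.
Variable z : 'cV[R]_n.
Hypothesis fz : ip_feasible A b z.
Hypothesis zmax : forall y, ip_feasible A b y -> dot c y <= dot c z.

Let G := near_opt_set A b c xs ls.

Definition optimum_found (best : option 'cV[R]_n) : bool :=
  if best is Some y then dot c z <= dot c y else false.

Definition optimum_open (t : bbtree n) : Prop :=
  exists2 p, unpruned_leaf t p & lp_feasible A b (fixings t p) z.

(** The first half yields the node count; the second keeps the LP value of every branched node at
    least [dot c z], which preserves the first. *)
Definition bb_inv (s : bbstate R n) : Prop :=
  covered G [::] s.1 /\ (optimum_found s.2 \/ optimum_open s.1).

Lemma bb_inv_init : bb_inv (bb_init R n).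
Proof.
split=> //; right; exists [::] => //=; split=> //; split; first exact: fz.1.
exact: binary_unit_box fz.2.
Qed.

Lemma update_best_found best x : optimum_found best || (dot c z <= dot c x) ->
  optimum_found (update_best c best x).
Proof.
case: best => [y|] //=; case: ltP => //= yx /orP[] // h.
  by apply: le_trans h (ltW yx).
exact: le_trans h yx.
Qed.

Lemma prune_open t p : unpruned_leaf t p -> optimum_open t ->
  ~ lp_feasible A b (fixings t p) z ->
  optimum_open (graft t p (Leaf true)).
Proof.
move=> tp [q tq qz] npz; have [qp|qp] := eqVneq q p.
  by case: npz; rewrite -qp.
have [tq' fq'] := graft_other_leaf (Leaf true) tp tq qp.
by exists q; rewrite ?fq'.
Qed.

(** A coordinate fixed by [F] has value 0 or 1 at [x]. *)
Lemma fractional_notin F x j : lp_feasible A b F x -> x j 0 \isn't a Num.int ->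
  j \notin unzip1 F.
Proof.
move=> [_ Fx]; apply: contra => /mapP[[i v] iF /= ->].
by rewrite (Fx _ _ iF) natr_int.
Qed.

(** If the optimum is found, failure to prune by bound gives the inequality. Otherwise an open leaf
    contains [z], and best-bound selection makes the chosen leaf at least as good. *)
Lemma branch_value t p best x : bb_inv (t, best) ->
  best_bound_leaf A b c t p -> lp_solution A b c (fixings t p) x ->
  ~ prune_by_bound A b c best (fixings t p) -> dot c z <= dot c x.
Proof.
move=> [_ /= inv] [tp pmax] xsol; rewrite /prune_by_bound (lp_optE xsol).
case: inv => [|[q tq qz] _]; last first.
  rewrite -lee_fin -(lp_optE xsol).
  by apply: le_trans (pmax _ tq); exact: lp_opt_ge.
case: best => //= y zy; rewrite lte_fin => /negP; rewrite -leNgt.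
exact: le_trans.
Qed.

Lemma bb_inv_step s s' : bb_inv s -> bb_step A b c s s' -> bb_inv s'.
Proof.
move=> + ss'; case: ss' => {s s'}.
- move=> t best p x [tp _] xsol _ [/= cov inv].
  split=> /=; first exact: covered_graft.
  (* If the leaf contains [z], its integral optimum [x] is as good as [z]; otherwise pruning it does
     not lose [z]. *)
  have [pz|npz] := pselect (lp_feasible A b (fixings t p) z).
    by left; apply: update_best_found; rewrite (xsol.2 _ pz) orbT.
  case: inv => [fd|op]; first by left; apply: update_best_found; rewrite fd.
  by right; exact: prune_open.
- move=> t best p [tp _] F0 [/= cov inv]; split=> /=; first exact: covered_graft.
  case: inv => [|op]; [by left|right].
  by apply: prune_open => //; rewrite F0.
- move=> t best p x [tp _] xsol _ pr [/= cov inv].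
  split=> /=; first exact: covered_graft.
  case: inv => [|op]; first by left.
  (* If the incumbent is worse than [z], the leaf value is below [dot c z], so [z] lies in another
     leaf. *)
  have [fd|nfd] := boolP (optimum_found best); [by left|right].
  apply: prune_open => // pz; move: pr nfd; case: best => //= y.
  rewrite (lp_optE xsol) lte_fin => xy; rewrite -ltNge => yz.
  by have := xsol.2 _ pz; rewrite leNgt (lt_trans xy yz).
- move=> t best p x j bb xsol _ npr xj inv; have [/= cov inv2] := inv.
  have zx := branch_value inv bb xsol npr.
  have tp := bb.1; have subp : subtree t p by rewrite tp.
  split=> /=.
    apply: covered_graft => //=; rewrite !andbT (fractional_notin xsol.1 xj).
    apply/exists_inP; exact: near_opt_rounding saddle fz zmax xsol.1 zx.
  case: inv2 => [|[q tq qz]]; [by left|right].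
  have [qp|qp] := eqVneq q p; last first.
    have [tq' fq'] :=
      graft_other_leaf (Branch j (Leaf false) (Leaf false)) tp tq qp.
    by exists q; rewrite ?fq'.
  (* When the branched leaf held [z], the child given by the bit [z j 0] still holds it. *)
  have [v zj] : exists v : bool, z j 0 = v%:R.
    by case: (fz.2 j) => ->; [exists false|exists true].
  exists (p ++ [:: v]); rewrite /unpruned_leaf.
    by rewrite subtree_graft//; case: v {zj}.
  rewrite fixings_graft//; rewrite qp in qz; case: qz => bz Fz; split=> // i w /=.
  rewrite mem_cat => /orP[|]; first exact: Fz.
  by case: v zj => zj /=; rewrite inE => /eqP[-> ->].
Qed.

Lemma bb_inv_reachable s : bb_reachable A b c s -> bb_inv s.
Proof.
move=> /clos_rt_rtn1_iff; elim=> [|s1 s2 s12 _]; first exact: bb_inv_init.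
by move=> inv; exact: bb_inv_step inv s12.
Qed.

(** * Termination by decreasing weight *)

Lemma weight_step s s' : bb_inv s -> bb_step A b c s s' ->
  (weight n s'.1 < weight n s.1)%N.
Proof.
move=> + ss'; case: ss' => {s s'} /=.
- by move=> t best p x [tp _] *; apply: weight_graft => //=; rewrite expn_gt0.
- by move=> t best p [tp _] *; apply: weight_graft => //=; rewrite expn_gt0.
- by move=> t best p x [tp _] *; apply: weight_graft => //=; rewrite expn_gt0.
move=> t best p x j [tp _] xsol _ _ xj [/= cov _]; apply: weight_graft => //=.
(* The fractional coordinate is new on the path, so the depth is below [n] and the exponent is
   positive. *)
have : uniq (j :: unzip1 (fixings t p)).
  by rewrite /= (fractional_notin xsol.1 xj)/= (uniq_fixings p cov).
move=> /card_uniqP sz; have := max_card (mem (j :: unzip1 (fixings t p))).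
rewrite sz /= card_ord size_map (size_fixings tp) => lt.
have -> : (n - size p = (n - size p).-1.+1)%N by lia.
(* Two children of weight [3^d] replace a leaf of weight [3^(d+1)]. *)
by rewrite /= expnS; have := expn_gt0 3 (n - size p).-1; lia.
Qed.

Lemma bb_acc s : bb_inv s -> Acc (fun s' s => bb_step A b c s s') s.
Proof.
elim: (weight n s.1).+1 {-2}s (leqnn (weight n s.1).+1) => {s} [|k IH] s lek inv.
  by rewrite ltn0 in lek.
constructor=> s' ss'; apply: IH; last exact: bb_inv_step inv ss'.
exact: leq_trans (weight_step inv ss') lek.
Qed.

End invariant.

(** * Progress and the bound on the final tree *)

Lemma bb_progress (R : realType) m n (A : 'M[R]_(m, n)) b c s :
  ~ bb_final s -> exists s', bb_step A b c s s'.
Proof.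
case: s => t best; rewrite /bb_final /= -existsNE => -[p0 /contrapT tp0].
(* A best-bound leaf exists; the cases on its LP then match the four kinds of iteration. *)
have [p tp pmax] := leaf_argmax (fun q => lp_opt A b c (fixings t q)) tp0.
have bb : best_bound_leaf A b c t p by [].
have [F0|/set0P/lp_solution_exists-/(_ c)[x xsol]] :=
    eqVneq (lp_feasible A b (fixings t p)) set0.
  by eexists; exact: BBInfeasible bb F0.
have [xint|xfrac] := pselect (integral x).
  by eexists; exact: BBIntegral bb xsol xint.
have [pr|npr] := pselect (prune_by_bound A b c best (fixings t p)).
  by eexists; exact: BBBound bb xsol xfrac pr.
have [j /negP xj] : exists j, ~ x j 0 \is a Num.int by apply/existsNP.
by eexists; exact: BBBranch bb xsol xfrac npr xj.
Qed.

Theorem theorem3 (R : realType) (m n : nat) (hm : (1 <= m)%N) (hn : (1 <= n)%N)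
    (A : 'M[R]_(m, n)) (b : 'cV[R]_m) (c : 'cV[R]_n)
    (hfeas : ip_feasible A b !=set0)
    (xs : 'cV[R]_n) (ls : 'cV[R]_m) (hsaddle : saddle_point A b c xs ls) :
  bb_terminates A b c /\
  forall t : bbtree n, bb_final_tree A b c t ->
    (nb_nodes t <= 2 * #|near_opt_set A b c xs ls| * n + 1)%N.
Proof.
have [z fz zmax] := ip_solution_exists c hfeas.
split.
  split; first exact: (bb_acc hsaddle fz zmax (bb_inv_init _ _ _ fz)).
  by move=> s _; exact: bb_progress.
move=> _ [s reach [_ <-]].
have [cov _] := bb_inv_reachable hsaddle fz zmax reach.
(* At the root no coordinate is fixed, so the subcube is all of {0,1}^n and all [n] levels
   remain. *)
have := nb_nodes_covered cov isT; rewrite subn0.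
by rewrite (_ : [set x in _ | _]%SET = near_opt_set A b c xs ls)//;
  apply/setP => x; rewrite !inE andbT.
Qed.
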